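(* We have $(S_1S_0)^m(1)=d_mP_m$ for $m\in\mathbb Z_+$ and $\bigl(S_0(S_1S_0)^{m-1}\bigr)(1)=d_{-m}P_{-m}$ for $m\in\mathbb N$, where $1\in\mathcal A$ is the constant polynomial and $$d_m=q^{-(m+1)m}k_0^{-2m}k_1^{-2m}\bigl(qk_0^2k_1^2;q\bigr)_{2m}\quad(m\in\mathbb Z_+),$$ $$d_{-m}=q^{-m^2}k_0^{1-2m}k_1^{-2m}\bigl(qk_0^2k_1^2;q\bigr)_{2m-1}\quad(m\in\mathbb N).$$
   Context: $\mathbb Z_+=\{0,1,2,\dots\}$, $\mathbb N=\{1,2,\dots\}$; $(y;q)_m=\prod_{j=0}^{m-1}(1-yq^j)$. Parameters: $q\in\mathbb C\setminus\{0\}$ with $|q|\ne1$ and a fixed square root $q^{1/2}$; $\underline t=(k_0,k_1,u_0,u_1)$ nonzero complex numbers with $k_0^2,k_1^2,u_1^2\notin\{\pm q^j:j\in\mathbb Z\}$ and $k_0^2k_1^2\neq q^{-j}$ for all integers $j\ge1$. $\mathcal A=\mathbb C[x^{\pm1}]$. Define linear operators on $\mathcal A$ by $(T_1f)(x)=k_1f(x)+k_1^{-1}\frac{(1-k_1u_1x)(1+k_1u_1^{-1}x)}{1-x^2}\bigl(f(x^{-1})-f(x)\bigr)$ and $(T_0f)(x)=k_0f(x)+k_0^{-1}\frac{(1-q^{1/2}k_0u_0x^{-1})(1+q^{1/2}k_0u_0^{-1}x^{-1})}{1-qx^{-2}}\bigl(f(qx^{-1})-f(x)\bigr)$; they satisfy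 $(T_i-k_i)(T_i+k_i^{-1})=0$, hence are invertible. Put $Y=T_1T_0$, let $z$ be multiplication by $x$, and $T_1^\vee=z^{-1}T_1^{-1}$. The intertwiners are $S_1=T_1Y-YT_1$ and $S_0=YT_1^\vee-T_1^\vee Y$. Let $\epsilon(m)=1$ for $m\ge0$, $\epsilon(m)=-1$ for $m<0$, $\gamma_m=(k_0k_1)^{\epsilon(m)}q^m$. Order the monomials by $1\prec x^{-1}\prec x\prec x^{-2}\prec x^2\prec\cdots$. The monic non-symmetric Askey-Wilson polynomial $P_m$ ($m\in\mathbb Z$) is the unique Laurent polynomial of the form $x^m+$ lower order terms w.r.t. $\preceq$ with $YP_m=\gamma_mP_m$. *)

(* Defs.v *)
From HB Require Import structures.
From mathcomp Require Import all_boot all_order all_algebra fraction.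
From mathcomp Require Import generic_quotient ring.
From mathcomp Require Import boolp classical_sets.

Set Implicit Arguments.
Unset Strict Implicit.
Unset Printing Implicit Defensive.

Import GRing.Theory.
Local Open Scope ring_scope.
Local Open Scope quotient_scope.

Section FieldIdentities.
Variables (L : fieldType).
Implicit Types a b c d f g k u w x A : L.

Lemma divf_sub a b c d : b != 0 -> d != 0 ->
  a / b - c / d = (a * d - c * b) / (b * d).
Proof. by move=> b0 d0; field; rewrite b0 d0. Qed.

Lemma divdiff_denom c x : x != 0 -> 1 - c / x ^+ 2 = (x ^+ 2 - c) / x ^+ 2.
Proof. by move=> x0; field. Qed.

Lemma divdiffM a b c d w : w != 0 ->
  (a * b - c * d) / w = (a - c) / w * b + c * ((b - d) / w).
Proof. by move=> w0; field. Qed.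

Lemma divdiffD a b c d w : w != 0 ->
  (a + b - (c + d)) / w = (a - c) / w + (b - d) / w.
Proof. by move=> w0; field. Qed.

Lemma divdiffX c x : x != 0 -> c / x - x = - x * (1 - c / x ^+ 2).
Proof. by move=> x0; field. Qed.

Lemma divdiffV c x : c != 0 -> x != 0 ->
  c^-1 * x - x^-1 = c^-1 * x * (1 - c / x ^+ 2).
Proof. by move=> c0 x0; field; rewrite c0 x0. Qed.

Lemma mulVX c x : c != 0 -> x != 0 -> 1 = c^-1 * x * (c / x).
Proof. by move=> c0 x0; field; rewrite c0 x0. Qed.

Lemma divdiffVX d x : x != 0 ->
  (1 - x ^+ 2)^-1 * d = - (x^-1 ^+ 2) * (d / (1 - 1 / x ^+ 2)).
Proof.
move=> x0; rewrite (divdiff_denom _ x0) invf_div exprVn.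
have x20 : x ^+ 2 != 0 by rewrite expf_neq0.
rewrite [RHS]mulrCA [_ * (x ^+ 2 / _)]mulrA mulNr mulVf // mulN1r.
by rewrite -invrN opprB mulrC.
Qed.

Lemma hecke_coef k u x : k != 0 -> u != 0 -> x != 0 -> 1 - x ^+ 2 != 0 ->
  let A y := k^-1 * ((1 - k * u * y) * (1 + k / u * y) / (1 - y ^+ 2)) in
  A x + A x^-1 = k + k^-1.
Proof.
move=> k0 u0 x0 w0 A; rewrite /A; field.
rewrite k0 u0 x0 w0 !andbT /=.
by rewrite -opprB oppr_eq0.
Qed.

Lemma hecke_quadratic k A A' f g : k != 0 -> A + A' = k + k^-1 ->
  let Tf := k * f + A * (g - f) in let Tg := k * g + A' * (f - g) in
  k * Tf + A * (Tg - Tf) = (k - k^-1) * Tf + f.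
Proof.
move=> k0 /(canRL (addKr A)) -> /=; field; exact: k0.
Qed.

Lemma hecke_op (s : {rmorphism L -> L}) k u x f :
  k != 0 -> u != 0 -> x != 0 -> 1 - x ^+ 2 != 0 ->
  s k = k -> s u = u -> s x = x^-1 -> s (s f) = f ->
  let T g := k * g + k^-1 * ((1 - k * u * x) * (1 + k / u * x) / (1 - x ^+ 2))
                     * (s g - g) in
  T (T f) = (k - k^-1) * T f + f.
Proof.
move=> k0 u0 x0 w0 sk su sx sf T.
have := hecke_coef k0 u0 x0 w0; cbv zeta beta.
set A := k^-1 * _; set A' := k^-1 * _ => AA'.
have sA : s A = A'.
  by rewrite /A !(rmorphM, rmorphB, rmorphD, rmorph1, fmorphV, rmorphXn) /=
             sk su sx.
rewrite -(hecke_quadratic f (s f) k0 AA') /T -/A {}/T.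
congr (_ + _ * (_ - _)); clearbody A A'.
by rewrite rmorphD !rmorphM rmorphB sf sk sA.
Qed.

Lemma affine_lin k a c f f' g g' :
  k * (c * f + g) + a * (c * f' + g' - (c * f + g)) =
  c * (k * f + a * (f' - f)) + (k * g + a * (g' - g)).
Proof. by ring. Qed.

End FieldIdentities.

Section RationalFunctions.
Variable F : fieldType.
(* the field F(x) of rational functions *)
Local Notation K := {fraction {poly F}}.
Implicit Types (u f g : K) (p : {poly F}).

Definition rconst (c : F) : K := tofrac c%:P.

Fact rconst_is_zmod_morphism : zmod_morphism rconst.
Proof. by move=> a b; rewrite /rconst polyCB tofracB. Qed.
Fact rconst_is_monoid_morphism : monoid_morphism rconst.
Proof. by split=> [|a b]; rewrite /rconst ?polyCM ?tofracM. Qed.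
HB.instance Definition _ :=
  GRing.isZmodMorphism.Build F K rconst rconst_is_zmod_morphism.
HB.instance Definition _ :=
  GRing.isMonoidMorphism.Build F K rconst rconst_is_monoid_morphism.

Definition rX : K := tofrac 'X.

Definition reval p u : K := (map_poly rconst p).[u].

(* f(u), computed from an arbitrary representation of f as a fraction; by
   [rsubst_frac] the choice is irrelevant as soon as u is transcendental
   over F, in particular for u = c / x with c != 0. *)
Definition rsubst u f : K := reval (repr f).1 u / reval (repr f).2 u.

Definition transcendental u := forall p, p != 0 -> reval p u != 0.

Lemma rX_neq0 : rX != 0.
Proof. by rewrite /rX tofrac_eq0 polyX_eq0. Qed.

Lemma tofrac_reval p : tofrac p = reval p rX.
Proof.
elim/poly_ind: p => [|p c IH]; first by rewrite /reval !rmorph0 horner0.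
by rewrite tofracD tofracM IH /reval rmorphD rmorphM /= map_polyX map_polyC
           !hornerE.
Qed.

Lemma transcendentalVX c : c != 0 -> transcendental (rconst c / rX).
Proof.
move=> c0 p p0; rewrite /reval horner_coef size_map_poly.
have sp0 : (0 < size p)%N by rewrite lt0n size_poly_eq0.
set d := (size p).-1.
apply: contraNneq (_ : lead_coef p * c ^+ d != 0); last first.
  by rewrite mulf_neq0 ?lead_coef_eq0 ?expf_neq0.
move=> /(congr1 (fun y => y * rX ^+ d)); rewrite mul0r mulr_suml.
pose r := \sum_(i < size p) (p`_i * c ^+ i)%:P * 'X^(d - i).
rewrite (_ : \sum_(i < _) _ = tofrac r); last first.
  rewrite /r rmorph_sum; apply: eq_bigr => i _.
  rewrite coef_map /= tofracM tofracXn -/rX -/(rconst _) rmorphM rmorphXn /=.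
  have le_id : (i <= d)%N by rewrite -ltnS prednK.
  have -> : rX ^+ d = rX ^+ i * rX ^+ (d - i) by rewrite -exprD subnKC.
  rewrite expr_div_n -!mulrA; congr (_ * (_ * _)).
  by rewrite mulrA mulVf ?mul1r // expf_neq0 // rX_neq0.
move=> /eqP; rewrite tofrac_eq0 => /eqP /(congr1 (fun s : {poly F} => s`_0)).
rewrite /r coef_sum coef0 => e; apply/eqP; rewrite -{}e.
have ltd : (d < size p)%N by rewrite prednK.
rewrite (bigD1 (Ordinal ltd)) //= subnn expr0 mulr1 coefC eqxx big1 ?addr0 //.
move=> i /negP ni; rewrite coefCM coefXn eq_sym subn_eq0.
rewrite (_ : (d <= i)%N = false) ?mulr0 //; apply/negP => di; apply: ni.
by apply/eqP/val_inj/eqP; rewrite /= eqn_leq di andbT -ltnS prednK.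
Qed.

Lemma frac_repr f : f = tofrac (repr f).1 / tofrac (repr f).2.
Proof.
have d0 : tofrac (repr f).2 != 0 by rewrite tofrac_eq0 denom_ratioP.
apply: (mulIf d0); rewrite divfK // -{1}[f]reprK; unlock FracField.tofrac.
rewrite -[LHS]FracField.pi_mul; apply/eqmodP.
rewrite /= FracField.equivfE /FracField.mulf /=.
by rewrite !numden_Ratio ?mulf_neq0 ?oner_neq0 ?denom_ratioP // !mulr1 mulrC.
Qed.

Lemma fracP f :
  exists a b : {poly F}, b != 0 /\ f = tofrac a / tofrac b.
Proof.
by exists (repr f).1, (repr f).2; split; [exact: denom_ratioP|exact: frac_repr].
Qed.

Lemma reval_is_zmod_morphism u : zmod_morphism (reval^~ u).
Proof. by move=> p r; rewrite /reval rmorphB hornerE hornerN. Qed.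
Lemma reval_is_monoid_morphism u : monoid_morphism (reval^~ u).
Proof. by split=> [|p r]; rewrite /reval ?rmorph1 ?rmorphM ?hornerC ?hornerM. Qed.

Lemma rsubst_frac u (a b : {poly F}) : transcendental u -> b != 0 ->
  rsubst u (tofrac a / tofrac b) = reval a u / reval b u.
Proof.
move=> tu b0; rewrite /rsubst.
have [f ef] : exists f, f = tofrac a / tofrac b by eexists.
rewrite -ef; move: ef; rewrite {1}(frac_repr f).
have := denom_ratioP (repr f); move: (repr f).1 (repr f).2 => c d d0 e.
have [_ rM] := reval_is_monoid_morphism u.
apply/eqP; rewrite eqr_div ?tu // -!rM; apply/eqP; congr (reval _ u).
by apply/eqP; rewrite -tofrac_eq !tofracM -eqr_div ?tofrac_eq0 // e.
Qed.

Lemma rsubst_is_zmod_morphism u : transcendental u -> zmod_morphism (rsubst u).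
Proof.
move=> tu f g; have [a [b [b0 ->]]] := fracP f; have [c [d [d0 ->]]] := fracP g.
rewrite divf_sub ?tofrac_eq0 // -!tofracM -tofracB !rsubst_frac ?mulf_neq0 //.
have [_ rM] := reval_is_monoid_morphism u.
by rewrite (reval_is_zmod_morphism u) !rM divf_sub ?tu.
Qed.

Lemma rsubst_is_monoid_morphism u :
  transcendental u -> monoid_morphism (rsubst u).
Proof.
have [r1 rM] := reval_is_monoid_morphism u.
move=> tu; split=> [|f g].
  have -> : (1 : K) = tofrac 1 / tofrac 1 by rewrite tofrac1 divr1.
  by rewrite rsubst_frac ?oner_neq0 // r1 divr1.
have [a [b [b0 ->]]] := fracP f; have [c [d [d0 ->]]] := fracP g.
rewrite mulf_div -!tofracM !rsubst_frac ?mulf_neq0 //.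
by rewrite !rM mulf_div.
Qed.

Lemma rsubst_const u c : transcendental u -> rsubst u (rconst c) = rconst c.
Proof.
move=> tu; have -> : rconst c = tofrac c%:P / tofrac 1 by rewrite tofrac1 divr1.
have [r1 _] := reval_is_monoid_morphism u.
rewrite rsubst_frac ?oner_neq0 // r1 divr1 tofrac1 divr1.
by rewrite /reval map_polyC hornerC.
Qed.

Lemma rsubst_X u : transcendental u -> rsubst u rX = u.
Proof.
move=> tu; have -> : rX = tofrac 'X / tofrac 1 by rewrite tofrac1 divr1.
have [r1 _] := reval_is_monoid_morphism u.
by rewrite rsubst_frac ?oner_neq0 // r1 divr1 /reval map_polyX hornerX.
Qed.

Lemma transcendental_invX : transcendental rX^-1.
Proof.
by have := transcendentalVX (oner_neq0 F); rewrite rmorph1 [1 / _]mul1r.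
Qed.

Lemma ratfun_invol (s : {rmorphism K -> K}) f :
  (forall c, s (rconst c) = rconst c) -> s (s rX) = rX -> s (s f) = f.
Proof.
move=> sC sX; have sP p : s (s (tofrac p)) = tofrac p.
  elim/poly_ind: p => [|p c IH]; first by rewrite tofrac0 !rmorph0.
  by rewrite tofracD tofracM !rmorphD !rmorphM IH sX !sC.
by have [a [b [_ ->]]] := fracP f; rewrite !fmorph_div !sP.
Qed.

Lemma rsubst_invol f : rsubst rX^-1 (rsubst rX^-1 f) = f.
Proof.
have tu := transcendental_invX.
pose sB := GRing.isZmodMorphism.Build K K _ (rsubst_is_zmod_morphism tu).
pose sM := GRing.isMonoidMorphism.Build K K _ (rsubst_is_monoid_morphism tu).
pose s : {rmorphism K -> K} := HB.pack (rsubst rX^-1) sB sM.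
have e : s rX = rX^-1 := rsubst_X tu.
apply: (@ratfun_invol s f) => [c|]; first exact: rsubst_const.
by rewrite e fmorphV e invrK.
Qed.

Lemma rsubst_linear u c f g : transcendental u ->
  rsubst u (rconst c * f + g) = rconst c * rsubst u f + rsubst u g.
Proof.
move=> tu; pose sB := GRing.isZmodMorphism.Build K K _ (rsubst_is_zmod_morphism tu).
pose s : {additive K -> K} := HB.pack (rsubst u) sB.
rewrite -[LHS]/(s (rconst c * f + g)) raddfD; congr (_ + _).
rewrite -{2}(rsubst_const c tu); have [_ sM] := rsubst_is_monoid_morphism tu.
exact: sM.
Qed.

Definition laurent_pred : pred K :=
  fun f => `[< exists (n : nat) p, f = tofrac p / rX ^+ n >].

Lemma laurentP f :
  reflect (exists (n : nat) p, f = tofrac p / rX ^+ n) (f \in laurent_pred).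
Proof. exact: asboolP. Qed.

Lemma laurent_subring : subring_closed laurent_pred.
Proof.
have x0 n : rX ^+ n != 0 by rewrite expf_neq0 // rX_neq0.
split=> [|f g|f g].
- by apply/laurentP; exists 0%N, 1; rewrite expr0 divr1 tofrac1.
- move=> /laurentP [n [p ->]] /laurentP [m [r ->]]; apply/laurentP.
  exists (n + m)%N, (p * 'X^m - r * 'X^n).
  by rewrite tofracB !tofracM !tofracXn -/rX exprD divf_sub ?x0.
- move=> /laurentP [n [p ->]] /laurentP [m [r ->]]; apply/laurentP.
  exists (n + m)%N, (p * r).
  by rewrite tofracM exprD mulf_div.
Qed.

HB.instance Definition _ :=
  GRing.isSubringClosed.Build K laurent_pred laurent_subring.

(* the algebra F[x, x^-1], as a subring of F(x) *)
Record laurent : Type := Laurent { ratl :> K; _ : ratl \in laurent_pred }.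

HB.instance Definition _ := [isSub for ratl].
HB.instance Definition _ := [Choice of laurent by <:].
HB.instance Definition _ := [SubChoice_isSubComNzRing of laurent by <:].

Lemma laurent_const (c : F) : rconst c \in laurent_pred.
Proof. by apply/laurentP; exists 0%N, c%:P; rewrite expr0 divr1. Qed.

Lemma laurent_mon (n : int) : rX ^ n \in laurent_pred.
Proof.
apply/laurentP; case: n => n.
  by exists 0%N, 'X^n; rewrite expr0 divr1 tofracXn.
by exists n.+1, 1; rewrite tofrac1 div1r.
Qed.

Definition lconst (c : F) : laurent := Laurent (laurent_const c).

Definition lmon (n : int) : laurent := Laurent (laurent_mon n).

Definition laurent_scale (c : F) (f : laurent) : laurent := lconst c * f.

Fact laurent_scaleA a b (f : laurent) :
  laurent_scale a (laurent_scale b f) = laurent_scale (a * b) f.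
Proof. by apply: val_inj; rewrite /= rmorphM mulrA. Qed.
Fact laurent_scale1 : left_id 1 laurent_scale.
Proof. by move=> f; apply: val_inj; rewrite /= rmorph1 mul1r. Qed.
Fact laurent_scaleDr : right_distributive laurent_scale +%R.
Proof. by move=> a f g; apply: val_inj; rewrite /= mulrDr. Qed.
Fact laurent_scaleDl (f : laurent) : {morph laurent_scale^~ f : a b / a + b}.
Proof. by move=> a b; apply: val_inj; rewrite /= rmorphD mulrDl. Qed.

HB.instance Definition _ := GRing.Zmodule_isLmodule.Build F laurent
  laurent_scaleA laurent_scale1 laurent_scaleDr laurent_scaleDl.

Lemma laurent_divdiff c f : c != 0 -> f \in laurent_pred ->
  (rsubst (rconst c / rX) f - f) / (1 - rconst c / rX ^+ 2) \in laurent_pred.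
Proof.
move=> c0 /laurentP [n [p ->]].
set u := rconst c / rX; set w := 1 - _.
have tu : transcendental u by exact: transcendentalVX.
have [s1 sM] := rsubst_is_monoid_morphism tu.
have sB := rsubst_is_zmod_morphism tu.
have s0 : rsubst u 0 = 0 by rewrite -[X in rsubst u X](subrr 0) sB subrr.
have sD g h : rsubst u (g + h) = rsubst u g + rsubst u h.
  by rewrite -[h in LHS]opprK sB -[- h]sub0r sB s0 sub0r opprK.
have x0 := rX_neq0.
have Xl : rX \in laurent_pred by exact: (laurent_mon 1).
have Vl : rX^-1 \in laurent_pred by exact: (laurent_mon (-1)).
have rc0 : rconst c != 0 by rewrite /rconst tofrac_eq0 polyC_eq0.
have w0 : w != 0.
  have -> : w = tofrac ('X^2 - c%:P) / rX ^+ 2.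
    rewrite /w divdiff_denom; last exact: x0.
    rewrite tofracB tofracXn.
    reflexivity.
  apply: mulf_neq0; last exact: (invr_neq0 (expf_neq0 2 x0)).
  rewrite tofrac_eq0 -lead_coef_eq0.
  rewrite lead_coefDl ?lead_coefXn ?oner_neq0 //.
  by rewrite size_polyN size_polyXn size_polyC c0.
pose D g := (rsubst u g - g) / w.
have DM g h : D (g * h) = D g * rsubst u h + g * D h.
  rewrite /D sM; exact: (divdiffM _ _ _ _ w0).
pose G g := [/\ g \in laurent_pred, rsubst u g \in laurent_pred &
                D g \in laurent_pred].
have ul : u \in laurent_pred by rewrite rpredM ?laurent_const.
have GM g h : G g -> G h -> G (g * h).
  move=> [? ? ?] [? ? ?]; split; first exact: rpredM.
    by rewrite sM; apply: rpredM.
  by rewrite DM; apply: rpredD; apply: rpredM.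
have GD g h : G g -> G h -> G (g + h).
  have DD : D (g + h) = D g + D h.
    by rewrite /D sD; exact: (divdiffD _ _ _ _ w0).
  move=> [? ? ?] [? ? ?]; split; first exact: rpredD.
    by rewrite sD; apply: rpredD.
  by rewrite DD; apply: rpredD.
have GC b : G (rconst b).
  split; rewrite /D ?rsubst_const ?laurent_const //.
  by rewrite subrr mul0r rpred0.
have GX : G rX.
  have sX : rsubst u rX = u by exact: rsubst_X.
  split; [exact: Xl | rewrite sX; exact: ul |].
  have -> : D rX = - rX.
    by apply: (mulIf w0); rewrite /D sX divfK //; exact: (divdiffX _ x0).
  by rewrite rpredN.
have GV : G rX^-1.
  have cxl : rconst c^-1 * rX \in laurent_pred.
    by apply: rpredM; [exact: laurent_const | exact: Xl].
  have sV : rsubst u rX^-1 = rconst c^-1 * rX.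
    have u0 : u != 0 by exact: (mulf_neq0 rc0 (invr_neq0 x0)).
    apply: (mulIf u0); rewrite -{2}(rsubst_X tu) -sM (mulVf x0) s1 /u fmorphV.
    exact: (mulVX rc0 x0).
  split; [exact: Vl | rewrite sV; exact: cxl |].
  have -> : D rX^-1 = rconst c^-1 * rX.
    apply: (mulIf w0); rewrite /D sV (divfK w0) /w fmorphV.
    exact: (divdiffV rc0 x0).
  exact: cxl.
have GVn : G (rX^-1 ^+ n).
  elim: n => [|n IH]; last by rewrite exprS; exact: GM.
  by rewrite expr0 -[1](rmorph1 rconst).
suff Gp : G (tofrac p) by rewrite -exprVn; have [] := GM _ _ Gp GVn.
elim/poly_ind: p => [|p b IH]; first by rewrite -polyC0; exact: GC.
by rewrite tofracD tofracM; apply: GD (GM _ _ IH GX) (GC b).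
Qed.

End RationalFunctions.

Section AskeyWilson.
Variable F : fieldType.
Local Notation K := {fraction {poly F}}.
Local Notation A := (laurent F).
Local Notation x := (rX F).

Definition qpoch (y q : F) (m : nat) : F := \prod_(j < m) (1 - y * q ^+ j).

(* The inverse of a bijective operator, see [op_inv_bij] and [T1_bij]. *)
Definition op_inv (T : A -> A) (f : A) : A := xget 0 [set g | T g = f].

(* qh is the chosen square root of q. *)
Variables (q qh k0 k1 u0 u1 : F).

Definition T1_rat (f : K) : K :=
  rconst k1 * f
  + rconst k1^-1
    * ((1 - rconst (k1 * u1) * x) * (1 + rconst (k1 * u1^-1) * x)
       / (1 - x ^+ 2))
    * (rsubst x^-1 f - f).

Definition T0_rat (f : K) : K :=
  rconst k0 * f
  + rconst k0^-1
    * ((1 - rconst (qh * k0 * u0) * x^-1)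
       * (1 + rconst (qh * k0 * u0^-1) * x^-1)
       / (1 - rconst q * x ^- 2))
    * (rsubst (rconst q * x^-1) f - f).

(* The default value 0 of insubd is never used if q != 0: see [T1E], [T0E]. *)
Definition T1 (f : A) : A := insubd 0 (T1_rat f).
Definition T0 (f : A) : A := insubd 0 (T0_rat f).

Definition Y (f : A) : A := T1 (T0 f).

Definition T1v (f : A) : A := lmon F (-1) * op_inv T1 f.

Definition S1 (f : A) : A := T1 (Y f) - Y (T1 f).
Definition S0 (f : A) : A := Y (T1v f) - T1v (Y f).

Definition eps (m : int) : int := if (0 <= m)%R then 1 else -1.
Definition gamma (m : int) : F := (k0 * k1) ^ eps m * q ^ m.

(* the position of x^n in the list 1, x^-1, x, x^-2, x^2, ... *)
Definition mon_rank (n : int) : nat :=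
  if (0 <= n)%R then (2 * `|n|)%N else (2 * `|n|).-1.
Definition mon_lt (n m : int) : bool := (mon_rank n < mon_rank m)%N.

Definition monic_of_degree (m : int) (P : A) : Prop :=
  exists (s : seq int) (c : int -> F),
    all (mon_lt^~ m) s /\ P = lmon F m + \sum_(n <- s) c n *: lmon F n.

Definition is_nonsym_AW (m : int) (P : A) : Prop :=
  monic_of_degree m P /\ Y P = gamma m *: P.

(* The definite description of P_m (0 if it does not exist). *)
Definition nonsym_AW (m : int) : A := xget 0 [set P | unique (is_nonsym_AW m) P].

Lemma T1_rat_laurent f : f \in @laurent_pred F -> T1_rat f \in @laurent_pred F.
Proof.
move=> fl.
have xl : x \in @laurent_pred F := laurent_mon F 1.
have Vl : x^-1 \in @laurent_pred F := laurent_mon F (-1).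
have Cl c : rconst c \in @laurent_pred F := laurent_const c.
have x0 := rX_neq0 F.
have := laurent_divdiff (oner_neq0 F) fl; rewrite rmorph1 [1 / x]mul1r => dl.
rewrite /T1_rat; apply: rpredD; first by (apply: rpredM; [exact: Cl | exact: fl]).
rewrite -mulrA; apply: rpredM; first exact: Cl.
have -> : (1 - rconst (k1 * u1) * x) * (1 + rconst (k1 * u1^-1) * x)
    / (1 - x ^+ 2) * (rsubst x^-1 f - f) =
    (1 - rconst (k1 * u1) * x) * (1 + rconst (k1 * u1^-1) * x)
    * (- (x^-1 ^+ 2) * ((rsubst x^-1 f - f) / (1 - 1 / x ^+ 2))).
  rewrite -!mulrA; congr (_ * (_ * _)). rewrite (divdiffVX _ x0).
  by rewrite mulrC.
have el c : rconst c * x \in @laurent_pred F.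
  by apply: rpredM; first [exact: Cl | exact: Vl | exact: xl].
apply: rpredM.
  by apply: rpredM; [apply: rpredB|apply: rpredD]; first [exact: rpred1 | exact: el].
by apply: rpredM dl; rewrite rpredN; apply: rpredX.
Qed.

Lemma T0_rat_laurent f : q != 0 ->
  f \in @laurent_pred F -> T0_rat f \in @laurent_pred F.
Proof.
move=> q0 fl.
have Vl : x^-1 \in @laurent_pred F := laurent_mon F (-1).
have Cl c : rconst c \in @laurent_pred F := laurent_const c.
have dl := laurent_divdiff q0 fl.
have el c : rconst c * x^-1 \in @laurent_pred F.
  by apply: rpredM; first [exact: Cl | exact: Vl | exact: xl].
rewrite /T0_rat; apply: rpredD; first by (apply: rpredM; [exact: Cl | exact: fl]).
rewrite -mulrA; apply: rpredM; first exact: Cl.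
rewrite mulrAC -mulrA; apply: rpredM; last exact: dl.
  by apply: rpredM; [apply: rpredB|apply: rpredD]; first [exact: rpred1 | exact: el].
Qed.

Lemma T1E f : ratl (T1 f) = T1_rat f.
Proof. by rewrite /T1 insubdK //; exact: T1_rat_laurent (valP f). Qed.

Lemma T0E f : q != 0 -> ratl (T0 f) = T0_rat f.
Proof. by move=> q0; rewrite /T0 insubdK //; exact: T0_rat_laurent (valP f). Qed.

Lemma op_inv_bij T f : bijective T -> T (op_inv T f) = f.
Proof.
move=> [T' TK T'K]; rewrite /op_inv.
by case: xgetP => [g _ //|/(_ (T' f))]; rewrite /= T'K.
Qed.

Lemma T1_rat_hecke f : k1 != 0 -> u1 != 0 ->
  T1_rat (T1_rat f) = rconst (k1 - k1^-1) * T1_rat f + f.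
Proof.
move=> k0' u0'.
have x0 := rX_neq0 F.
have w0 : 1 - x ^+ 2 != 0.
  rewrite -tofrac1 -tofracXn -tofracB tofrac_eq0 -opprB oppr_eq0.
  by rewrite -size_poly_eq0 size_XnsubC.
have tu := @transcendental_invX F.
pose sB := GRing.isZmodMorphism.Build K K _ (rsubst_is_zmod_morphism tu).
pose sM := GRing.isMonoidMorphism.Build K K _ (rsubst_is_monoid_morphism tu).
pose s' : {rmorphism K -> K} := HB.pack (rsubst x^-1) sB sM.
have : forall g, rsubst x^-1 g = s' g by [].
have : forall c, s' (rconst c) = rconst c by move=> c; exact: (rsubst_const c tu).
have : s' x = x^-1 by exact: (rsubst_X tu).
have : s' (s' f) = f by exact: rsubst_invol.
rewrite /T1_rat; move: s' => s sf sX sC sE; rewrite !{}sE.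
have rk0 : rconst k1 != 0 by rewrite fmorph_eq0.
have ru0 : rconst u1 != 0 by rewrite fmorph_eq0.
rewrite !(rmorphM (@rconst F)) rmorphB !fmorphV.
exact: (hecke_op rk0 ru0 x0 w0 (sC _) (sC _) sX sf).
Qed.

Lemma T1_hecke f : k1 != 0 -> u1 != 0 -> T1 (T1 f) = (k1 - k1^-1) *: T1 f + f.
Proof.
move=> k0' u0'; apply: val_inj.
rewrite -[LHS]/(ratl (T1 (T1 f))) -[RHS]/(rconst _ * ratl (T1 f) + ratl f).
by rewrite !T1E T1_rat_hecke.
Qed.

Lemma T1_linear : linear T1.
Proof.
move=> c f g; apply: val_inj.
rewrite -[LHS]/(ratl (T1 (c *: f + g))).
rewrite -[RHS]/(rconst c * ratl (T1 f) + ratl (T1 g)) !T1E.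
rewrite -[ratl (c *: f + g)]/(rconst c * ratl f + ratl g).
rewrite /T1_rat (rsubst_linear _ _ _ (@transcendental_invX F)).
exact: affine_lin.
Qed.

Lemma T0_linear : q != 0 -> linear T0.
Proof.
move=> q0 c f g; apply: val_inj.
rewrite -[LHS]/(ratl (T0 (c *: f + g))).
rewrite -[RHS]/(rconst c * ratl (T0 f) + ratl (T0 g)) !T0E //.
rewrite -[ratl (c *: f + g)]/(rconst c * ratl f + ratl g).
rewrite /T0_rat (rsubst_linear _ _ _ (transcendentalVX q0)).
exact: affine_lin.
Qed.

Lemma T1_bij : k1 != 0 -> u1 != 0 -> bijective T1.
Proof.
move=> k1n0 u1n0; set a := k1 - k1^-1.
exists (fun f => T1 f - a *: f) => f; rewrite ?T1_hecke // -/a.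
  by rewrite addrAC subrr add0r.
have -> : T1 f - a *: f = (- a) *: f + T1 f by rewrite scaleNr addrC.
by rewrite T1_linear T1_hecke // scaleNr addKr.
Qed.

End AskeyWilson.

(* Main.v *)
From HB Require Import structures.
Require Import Defs.
From mathcomp Require Import all_boot all_order all_algebra reals complex.
From mathcomp Require Import classical_sets ring zify.

Set Implicit Arguments.
Unset Strict Implicit.
Unset Printing Implicit Defensive.

Import Order.TTheory GRing.Theory Num.Theory.
Local Open Scope ring_scope.
Local Open Scope complex_scope.

(* If Y f = g f, the Hecke relations show that T1 f and T1v f span together
   with f two Y-stable planes, with second eigenvalues 1/g and 1/(q g).  Hence
   S1 f = (g - 1/g) T1 f + c f and S0 f = (1/(q g) - g) T1 (x f) + c' f are
   eigenvectors, and the iterates of S0 and S1 on 1 have eigenvalues gamma_0,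
   gamma_(-1), gamma_1, gamma_(-2), ...  Only the leading terms of T1 x^n are
   needed to see that the k-th iterate is a multiple AWlead k of the k-th
   monomial plus lower terms.  The eigenvalues being distinct, AWlead k is
   nonzero and the iterates form a triangular eigenbasis, so the normalized
   iterates are the unique polynomials P_m.  The triangularity of Y itself is
   never used. *)

(** * Rational-function identities behind the Hecke relations *)

Section ShiftIdentities.
Variable L : fieldType.
Implicit Types f g k qh u x : L.

(** Here [g] stands for f(x^-1). Its terms cancel, and in the coefficient of [f] the factor x^-1 - x
    cancels the denominator of [c]. *)
Lemma T1_shift_field k u x f g : k != 0 -> u != 0 -> x != 0 -> 1 - x ^+ 2 != 0 ->
  let c := k^-1 * ((1 - k * u * x) * (1 + k / u * x) / (1 - x ^+ 2)) in
  k * (x * f) + c * (x^-1 * g - x * f) =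
  x^-1 * (k * f + c * (g - f) - (k - k^-1) * f) - (u - u^-1) * f.
Proof. by move=> k0 u0 x0 w0 c; rewrite /c; field; rewrite k0 u0 x0 w0. Qed.

Lemma T0_shift_field qh k u x f g : qh != 0 -> k != 0 -> u != 0 -> x != 0 ->
  1 - qh ^+ 2 * x ^- 2 != 0 ->
  let c := k^-1 * ((1 - qh * k * u * x^-1) * (1 + qh * k / u * x^-1)
                   / (1 - qh ^+ 2 * x ^- 2)) in
  k * (x^-1 * f) + c * ((qh ^+ 2)^-1 * x * g - x^-1 * f) =
  (qh ^+ 2)^-1 * (x * (k * f + c * (g - f) - (k - k^-1) * f))
  - qh^-1 * (u - u^-1) * f.
Proof.
move=> q0 k0 u0 x0 w0 c; rewrite /c; field; rewrite q0 k0 u0 x0 /= ?andbT.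
by apply: contraNneq w0 => w0; rewrite divdiff_denom // w0 mul0r.
Qed.

(* [hecke_op] at the point y = q^(1/2) / x, which the substitution inverts. *)
Lemma T0_hecke_field (s : {rmorphism L -> L}) qh k u x f :
  qh != 0 -> k != 0 -> u != 0 -> x != 0 -> 1 - qh ^+ 2 * x ^- 2 != 0 ->
  s qh = qh -> s k = k -> s u = u -> s x = qh ^+ 2 / x -> s (s f) = f ->
  let T g := k * g + k^-1 * ((1 - qh * k * u * x^-1) * (1 + qh * k / u * x^-1)
                             / (1 - qh ^+ 2 * x ^- 2)) * (s g - g) in
  T (T f) = (k - k^-1) * T f + f.
Proof.
move=> q0 k0 u0 x0 w0 sq sk su sx sf T.
have y0 : qh / x != 0 by rewrite mulf_neq0 ?invr_neq0.
have yE : (qh / x) ^+ 2 = qh ^+ 2 * x ^- 2 by rewrite exprMn exprVn.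
have sy : s (qh / x) = (qh / x)^-1.
  by rewrite rmorphM fmorphV sx sq; field; rewrite q0 x0.
have w0' : 1 - (qh / x) ^+ 2 != 0 by rewrite yE.
have := hecke_op k0 u0 y0 w0' sk su sy sf; cbv zeta.
have e k' : k * k' * (qh / x) = qh * k * k' * x^-1 by ring.
by rewrite yE !e.
Qed.

End ShiftIdentities.

(** * Hecke relations of the operators on Laurent polynomials *)

Section HeckeRelations.
Variable F : fieldType.
Local Notation K := {fraction {poly F}}.
Local Notation A := (laurent F).
Local Notation x := (rX F).

(** Makes the [rmorph] lemmas available for a substitution; the existential keeps the packed
    structure opaque. *)
Lemma rsubst_rmorphism (u : K) :
  transcendental u -> exists s : {rmorphism K -> K}, s =1 rsubst u.
Proof.
move=> tu.
pose sB := GRing.isZmodMorphism.Build K K _ (rsubst_is_zmod_morphism tu).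
pose sM := GRing.isMonoidMorphism.Build K K _ (rsubst_is_monoid_morphism tu).
pose s : {rmorphism K -> K} := HB.pack (rsubst u) sB sM.
by exists s.
Qed.

Lemma rX_sqr_neq_const (c : F) : x ^+ 2 - rconst c != 0.
Proof.
by rewrite -tofracXn -tofracB tofrac_eq0 -size_poly_eq0 size_XnsubC.
Qed.

Variables (q qh k0 k1 u0 u1 : F).
Hypotheses (q_neq0 : q != 0) (qhE : qh ^+ 2 = q).
Hypotheses (k0_neq0 : k0 != 0) (k1_neq0 : k1 != 0).
Hypotheses (u0_neq0 : u0 != 0) (u1_neq0 : u1 != 0).

Local Notation T1 := (T1 k1 u1).
Local Notation T0 := (T0 q qh k0 u0).

Lemma qh_neq0 : qh != 0.
Proof. by apply: contraNneq q_neq0 => qh0; rewrite -qhE qh0 expr0n. Qed.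

Lemma denom1_neq0 : 1 - x ^+ 2 != 0.
Proof. by rewrite -opprB oppr_eq0 -(rmorph1 (@rconst F)) rX_sqr_neq_const. Qed.

Lemma denom0_neq0 : 1 - rconst q * x ^- 2 != 0.
Proof.
rewrite (divdiff_denom _ (rX_neq0 F)) mulf_neq0 ?rX_sqr_neq_const //.
by rewrite invr_neq0 // expf_neq0 // rX_neq0.
Qed.

(* The Hecke relation of T1v = x^-1 T1^-1, whose parameter is u1. *)
Lemma T1_shift (f : A) : T1 (lmon F 1 * f) =
  lmon F (-1) * (T1 f - (k1 - k1^-1) *: f) - (u1 - u1^-1) *: f.
Proof.
apply: val_inj; rewrite -[LHS]/(ratl (T1 _)) T1E /T1_rat.
rewrite -[ratl (lmon F 1 * f)]/(x * ratl f).
have [s sE] := rsubst_rmorphism (@transcendental_invX F).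
have sX : s x = x^-1 by rewrite sE rsubst_X //; exact: transcendental_invX.
rewrite -!sE (rmorphM s) sX.
rewrite -[RHS]/(x^-1 * (ratl (T1 f) - rconst (k1 - k1^-1) * ratl f)
   - rconst (u1 - u1^-1) * ratl f) T1E /T1_rat -!sE.
rewrite !(rmorphM (@rconst F)) !rmorphB !fmorphV.
by apply: T1_shift_field; rewrite ?fmorph_eq0 ?rX_neq0 ?denom1_neq0.
Qed.

(* The Hecke relation of T0v = q^(-1/2) T0^-1 x, whose parameter is u0. *)
Lemma T0_shift (f : A) : T0 (lmon F (-1) * f) =
  q^-1 *: (lmon F 1 * (T0 f - (k0 - k0^-1) *: f))
  - (qh^-1 * (u0 - u0^-1)) *: f.
Proof.
apply: val_inj; rewrite -[LHS]/(ratl (T0 _)) T0E // /T0_rat.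
rewrite -[ratl (lmon F (-1) * f)]/(x^-1 * ratl f).
have tu := transcendentalVX q_neq0.
have [s sE] := rsubst_rmorphism tu.
have sX : s x^-1 = (rconst q)^-1 * x.
  by rewrite fmorphV sE rsubst_X // invf_div mulrC.
rewrite -!sE (rmorphM s) sX.
rewrite -[RHS]/(rconst q^-1 * (x * (ratl (T0 f) - rconst (k0 - k0^-1) * ratl f))
   - rconst (qh^-1 * (u0 - u0^-1)) * ratl f) T0E // /T0_rat -!sE.
have := denom0_neq0; rewrite -qhE.
rewrite !(rmorphM (@rconst F)) !rmorphB !fmorphV rmorphXn => w0.
by apply: T0_shift_field; rewrite ?fmorph_eq0 ?rX_neq0 ?qh_neq0.
Qed.

Lemma T0_hecke (f : A) : T0 (T0 f) = (k0 - k0^-1) *: T0 f + f.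
Proof.
apply: val_inj.
rewrite -[LHS]/(ratl (T0 (T0 f))) -[RHS]/(rconst _ * ratl (T0 f) + ratl f).
rewrite !T0E // /T0_rat; move: (ratl f) => {}f.
have tu := transcendentalVX q_neq0.
have [s sE] := rsubst_rmorphism tu.
have sC c : s (rconst c) = rconst c by rewrite sE rsubst_const.
have sX : s x = rconst q / x by rewrite sE rsubst_X.
have rq0 : rconst q != 0 by rewrite fmorph_eq0.
have x0 := rX_neq0 F.
(* The substitution x -> q/x is an involution: it fixes constants, so checking the generator x
   suffices. *)
have ssf : s (s f) = f.
  apply: ratfun_invol => [c|]; first by rewrite !sC.
  rewrite sX (rmorphM s) sC (fmorphV s x) sX invf_div mulrCA.
  by rewrite (mulfV rq0) mulr1.
rewrite -!sE !(rmorphM (@rconst F)) !rmorphB !fmorphV.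
(* [T0_hecke_field] is stated in the square root of q, so q is replaced by [qh ^+ 2]. *)
have := denom0_neq0; move: sX; rewrite -qhE (rmorphXn (@rconst F)) => sX w0.
have rqh0 : rconst qh != 0 by rewrite fmorph_eq0 qh_neq0.
have rk0 : rconst k0 != 0 by rewrite fmorph_eq0.
have ru0 : rconst u0 != 0 by rewrite fmorph_eq0.
exact: (T0_hecke_field rqh0 rk0 ru0 x0 w0 (sC _) (sC _) (sC _) sX ssf).
Qed.

End HeckeRelations.

(** * The monomial order and its filtration *)

Definition mon_unrank (k : nat) : int :=
  if odd k then - (uphalf k)%:Z else k./2%:Z.

Lemma mon_rankK : cancel mon_rank mon_unrank.
Proof.
by move=> n; rewrite /mon_unrank /mon_rank uphalfE; case: (0 <= n) / boolP => ? /=;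
  case: ifP; lia.
Qed.

Lemma mon_unrankK : cancel mon_unrank mon_rank.
Proof.
by move=> k; rewrite /mon_unrank /mon_rank uphalfE; case: (odd k) / boolP => ? /=;
  try case: ifP; lia.
Qed.

Lemma mon_rank_nat (n : nat) : mon_rank n = n.*2.
Proof. by rewrite /mon_rank /=; lia. Qed.

Lemma mon_rank_opp (n : nat) : mon_rank (- n%:Z) = n.*2.-1.
Proof. by case: n => [|n]; rewrite /mon_rank /=; lia. Qed.

Lemma mon_unrank_double n : mon_unrank n.*2 = n.
Proof. by rewrite /mon_unrank odd_double doubleK. Qed.

Lemma mon_unrank_doubleS n : mon_unrank n.*2.+1 = - n.+1%:Z.
Proof. by rewrite /mon_unrank /= odd_double /= doubleK. Qed.

Section MonomialFiltration.
Variable F : fieldType.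
Local Notation A := (laurent F).

Lemma laurent_scaleAl (c : F) (f g : A) : (c *: f) * g = c *: (f * g).
Proof. exact/esym/mulrA. Qed.

Lemma laurent_scaleAr (c : F) (f g : A) : f * (c *: g) = c *: (f * g).
Proof. by rewrite mulrC laurent_scaleAl mulrC. Qed.

Lemma lmonD m n : lmon F (m + n) = lmon F m * lmon F n.
Proof. by apply: val_inj; rewrite /= expfzDr ?rX_neq0. Qed.

Lemma lmon0 : lmon F 0 = 1.
Proof. exact: val_inj. Qed.

(** Span of an initial segment of the ordered monomials: triangularity becomes a bound on a natural
    number. The coefficients form a total function, so their type does not depend on [r]. *)
Definition low (r : nat) (f : A) : Prop :=
  exists c : nat -> F, f = \sum_(k < r) c k *: lmon F (mon_unrank k).

Lemma low_mon r n : (mon_rank n < r)%N -> low r (lmon F n).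
Proof.
move=> lt_nr; exists (fun k => (k == mon_rank n)%:R).
rewrite (bigD1 (Ordinal lt_nr)) //= eqxx scale1r mon_rankK big1 ?addr0 //.
move=> i /negPf; rewrite -val_eqE /= => ->; exact: scale0r.
Qed.

Lemma lowD r f g : low r f -> low r g -> low r (f + g).
Proof.
move=> [c ->] [d ->]; exists (fun k => c k + d k).
by rewrite -big_split; apply: eq_bigr => i _; rewrite scalerDl.
Qed.

Lemma lowZ r a f : low r f -> low r (a *: f).
Proof.
move=> [c ->]; exists (fun k => a * c k).
by rewrite scaler_sumr; apply: eq_bigr => i _; rewrite scalerA.
Qed.

Lemma lowN r f : low r f -> low r (- f).
Proof. by rewrite -scaleN1r; apply: lowZ. Qed.

Lemma low0 r : low r 0.
Proof. by exists (fun _ => 0); rewrite big1 // => i _; rewrite scale0r. Qed.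

Lemma low_sum (I : eqType) (s : seq I) (G : I -> A) r :
  (forall i, i \in s -> low r (G i)) -> low r (\sum_(i <- s) G i).
Proof.
by move=> lowG; rewrite big_seq; elim/big_ind: _ => //; [exact: low0|exact: lowD].
Qed.

Lemma low_map (L : {linear A -> A}) r r' f :
  (forall n, (mon_rank n < r)%N -> low r' (L (lmon F n))) ->
  low r f -> low r' (L f).
Proof.
move=> lowL [c ->]; rewrite linear_sum; apply: low_sum => k _.
by rewrite linearZ; apply/lowZ/lowL; rewrite mon_unrankK.
Qed.

Lemma low_mulmon j r r' f :
  (forall n, (mon_rank n < r)%N -> (mon_rank (j + n) < r')%N) ->
  low r f -> low r' (lmon F j * f).
Proof.
move=> rank_j [c ->]; rewrite mulr_sumr; apply: low_sum => k _.
rewrite laurent_scaleAr -lmonD; apply/lowZ/low_mon/rank_j.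
by rewrite mon_unrankK.
Qed.

Lemma lowS r r' f : (r <= r')%N -> low r f -> low r' f.
Proof.
move=> le_r [c ->]; apply: low_sum => k _; apply/lowZ/low_mon.
by rewrite mon_unrankK (leq_trans _ le_r).
Qed.

(** The list of exponents in the definition may have gaps or repetitions; [low] merges it into one
    coefficient per monomial. Conversely, the list of all preceding exponents serves. *)
Lemma monic_of_degreeP m (P : A) :
  monic_of_degree m P <-> low (mon_rank m) (P - lmon F m).
Proof.
split=> [[s [c [/allP lt_s ->]]]|[c /(canRL (subrK _)) ->]].
  rewrite addrC addKr; apply: low_sum => n /lt_s lt_n.
  exact/lowZ/low_mon.
exists [seq mon_unrank k | k <- iota 0 (mon_rank m)], (c \o mon_rank); split.
  apply/allP => _ /mapP[k + ->]; rewrite mem_iota /mon_lt mon_unrankK.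
  by case/andP.
rewrite addrC big_map; congr (_ + _).
rewrite -(big_mkord xpredT (fun k => c k *: lmon F (mon_unrank k))).
rewrite /index_iota subn0.
by apply: eq_bigr => k _; rewrite /= mon_unrankK.
Qed.

End MonomialFiltration.

(** * Eigenvectors of a linear operator *)

Section Eigenvectors.
Variables (F : fieldType) (V : lmodType F) (L : {linear V -> V}).

(** On the span of [f] and [h] the operator is triangular with eigenvalues [g] and [e], so (L - e)(L
    - g) vanishes there. *)
Lemma shift_eigenvector (g e c : F) (f h : V) :
  L f = g *: f -> L h = e *: h + c *: f ->
  L (L h - g *: h) = e *: (L h - g *: h).
Proof.
move=> Lf Lh; have -> : L h - g *: h = (e - g) *: h + c *: f.
  by rewrite Lh scalerBl addrAC.
rewrite linearP linearZ /= Lf Lh !scalerDr !scalerA -addrA -scalerDl.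
by rewrite [e * (e - g)]mulrC; congr (_ + _ *: _); ring.
Qed.

Let kill (s : seq F) (f : V) : V := foldr (fun c g => L g - c *: g) f s.

Let kill_sum s n (G : 'I_n -> V) : kill s (\sum_i G i) = \sum_i kill s (G i).
Proof.
by elim: s => //= c s ->; rewrite linear_sum scaler_sumr -sumrB.
Qed.

Let kill_eigen s e a f :
  L f = e *: f -> kill s (a *: f) = (a * \prod_(c <- s) (e - c)) *: f.
Proof.
move=> Lf; elim: s => /= [|c s ->]; first by rewrite big_nil mulr1.
by rewrite big_cons linearZ /= Lf !scalerA -scalerBl; congr (_ *: _); ring.
Qed.

(* The product of the operators L - e j kills the sum, but multiplies an
   eigenvector for g by the nonzero scalar prod_j (g - e j). *)
Lemma eigen_sum_eq0 n (E : nat -> V) (e a : nat -> F) (g : F) f :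
  (forall k, L (E k) = e k *: E k) -> (forall k, (k < n)%N -> e k != g) ->
  f = \sum_(k < n) a k *: E k -> L f = g *: f -> f = 0.
Proof.
move=> LE e_neq fE Lf; pose s := [seq e k | k <- iota 0 n].
have : kill s f = 0.
  rewrite fE kill_sum big1 // => k _; rewrite (kill_eigen _ _ (LE k)).
  have e_s : e k \in s by apply/mapP; exists (k : nat); rewrite ?mem_iota /=.
  by rewrite (big_rem _ e_s) /= subrr mul0r mulr0 scale0r.
rewrite -[f in kill s f]scale1r (kill_eigen _ _ Lf) mul1r => /eqP.
rewrite scaler_eq0 => /orP[|/eqP //]; rewrite prodf_seq_eq0 => /hasP[c].
case/mapP=> k; rewrite mem_iota => /= lt_k -> /=.
by rewrite subr_eq0 eq_sym (negPf (e_neq _ lt_k)).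
Qed.

End Eigenvectors.

(** * Intertwiners of abstract operators satisfying the relations *)

Section Intertwiners.
Variable F : fieldType.
Local Notation A := (laurent F).
Local Notation x n := (lmon F n).
Variables (q k0 k1 b0 b1 : F) (T0 T1 : {linear A -> A}).
Hypotheses (q_neq0 : q != 0) (k0_neq0 : k0 != 0) (k1_neq0 : k1 != 0).
Local Notation a0 := (k0 - k0^-1).
Local Notation a1 := (k1 - k1^-1).
Hypothesis T0_hecke : forall f, T0 (T0 f) = a0 *: T0 f + f.
Hypothesis T1_hecke : forall f, T1 (T1 f) = a1 *: T1 f + f.
Hypothesis T0_shift : forall f,
  T0 (x (-1) * f) = q^-1 *: (x 1 * (T0 f - a0 *: f)) - b0 *: f.
Hypothesis T1_shift : forall f,
  T1 (x 1 * f) = x (-1) * (T1 f - a1 *: f) - b1 *: f.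
Hypothesis T0_1 : T0 1 = k0 *: (1 : A).
Hypothesis T1_1 : T1 1 = k1 *: (1 : A).

Definition Yop : A -> A := T1 \o T0.
HB.instance Definition _ := GRing.Linear.on Yop.
Arguments Yop : simpl never.

Lemma YopE f : T1 (T0 f) = Yop f.
Proof. by []. Qed.

(* T1v, with T1^-1 = T1 - a1 substituted. *)
Definition Vop (f : A) : A := x (-1) * (T1 f - a1 *: f).

(** Reduces the leading term of [intertw0] to the values of [T1] on monomials. *)
Lemma Vop_shift f : Vop f = T1 (x 1 * f) + b1 *: f.
Proof. by rewrite T1_shift subrK. Qed.

(** T0 = T1^-1 Y, and the quadratic relation gives T1^-1 = T1 - a1. *)
Lemma T0_eigen g f : Yop f = g *: f -> T0 f = g *: (T1 f - a1 *: f).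
Proof.
move=> Yf; rewrite scalerBr scalerA mulrC -scalerA -[g *: f]Yf -[g *: T1 f]linearZ.
by rewrite /= -Yf -YopE T1_hecke addrAC subrr add0r.
Qed.

(** By [T0_eigen], T1 f is g^-1 T0 f + a1 f, and Y T0 f = T1 T0^2 f = a0 Y f + T1 f by the quadratic
    relation of T0. *)
Lemma Y_T1_eigen g f : g != 0 -> Yop f = g *: f ->
  Yop (T1 f) = g^-1 *: T1 f + (a0 + a1 * g) *: f.
Proof.
move=> g0 Yf; have T1f : T1 f = g^-1 *: T0 f + a1 *: f.
  by rewrite (T0_eigen Yf) scalerA mulVf // scale1r subrK.
rewrite {1}T1f linearP linearZ /= Yf.
rewrite -[Yop (T0 f)]YopE T0_hecke linearP /= YopE Yf.
rewrite !scalerDr !scalerA addrAC -scalerDl addrC.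
by rewrite mulrAC mulVf // mul1r.
Qed.

(** [Vop f] is g^-1 x^-1 T0 f. Applying [T0_shift] at T0 f gives q^-1 x f - b0 T0 f, and T1 (x f) is
    again [Vop f] up to a multiple of f. *)
Lemma Y_Vop_eigen g f : g != 0 -> Yop f = g *: f ->
  Yop (Vop f) = (q * g)^-1 *: Vop f + (- (q * g)^-1 * b1 - b0) *: f.
Proof.
move=> g0 Yf; have VE : Vop f = g^-1 *: (x (-1) * T0 f).
  by rewrite (T0_eigen Yf) laurent_scaleAr scalerA mulVf // scale1r.
rewrite {1}VE linearZ /= -[Yop _]YopE T0_shift T0_hecke.
rewrite [_ + f]addrC addrK linearB !linearZ /= YopE Yf T1_shift -/(Vop f).
rewrite scalerN !scalerBr !scalerA scalerBl mulNr scaleNr.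
by rewrite -invfM [g * q]mulrC mulrAC mulVf // mul1r addrA.
Qed.

Definition intertw1 (f : A) : A := T1 (Yop f) - Yop (T1 f).
Definition intertw0 (f : A) : A := Yop (Vop f) - Vop (Yop f).

Lemma VopZ c f : Vop (c *: f) = c *: Vop f.
Proof.
by rewrite /Vop linearZ /= scalerA [_ * c]mulrC -scalerA -scalerBr laurent_scaleAr.
Qed.

Lemma intertw1E g f : g != 0 -> Yop f = g *: f ->
  intertw1 f = (g - g^-1) *: T1 f - (a0 + a1 * g) *: f.
Proof.
move=> g0 Yf; rewrite /intertw1 (Y_T1_eigen g0 Yf) Yf linearZ /=.
by rewrite opprD addrA scalerBl.
Qed.

Lemma intertw1_eigen g f : g != 0 -> Yop f = g *: f ->
  Yop (intertw1 f) = g^-1 *: intertw1 f.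
Proof.
move=> g0 Yf; have -> : intertw1 f = - (Yop (T1 f) - g *: T1 f).
  by rewrite opprB /intertw1 Yf linearZ.
by rewrite linearN scalerN /= (shift_eigenvector Yf (Y_T1_eigen g0 Yf)).
Qed.

Lemma intertw0_VE g f : Yop f = g *: f -> intertw0 f = Yop (Vop f) - g *: Vop f.
Proof. by move=> Yf; rewrite /intertw0 Yf VopZ. Qed.

(** The scalar [c] stays existential because [f] contributes only lower terms. *)
Lemma intertw0E g f : g != 0 -> Yop f = g *: f -> exists c,
  intertw0 f = ((q * g)^-1 - g) *: T1 (x 1 * f) + c *: f.
Proof.
move=> g0 Yf; rewrite (intertw0_VE Yf) (Y_Vop_eigen g0 Yf) addrAC -scalerBl.
rewrite Vop_shift scalerDr -addrA scalerA -scalerDl.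
by eexists.
Qed.

Lemma intertw0_eigen g f : g != 0 -> Yop f = g *: f ->
  Yop (intertw0 f) = (q * g)^-1 *: intertw0 f.
Proof.
move=> g0 Yf; rewrite (intertw0_VE Yf).
exact: shift_eigenvector Yf (Y_Vop_eigen g0 Yf).
Qed.

(** * Leading terms of [T1] on monomials *)

(** Induction through [T1_shift]: multiplication by x^-1 moves the leading term from x^(-n-1) to
    x^(-n-2). The remainder has exponents from -n to n. *)
Lemma T1_lmon_pos n : exists2 g, low n.*2.+1 g &
  T1 (x n.+1) = k1^-1 *: x (- n.+1%:Z) + g.
Proof.
elim: n => [|n [g low_g IH]].
  exists (- b1 *: (1 : A)); first by rewrite -lmon0; apply/lowZ/low_mon.
  rewrite -[x 1]mulr1 T1_shift T1_1 -scalerBl subKr.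
  by rewrite laurent_scaleAr mulr1 scaleNr.
exists (x (-1) * g - a1 *: x n - b1 *: x n.+1); last first.
  rewrite -[n.+2%:Z]/(1 + n.+1%:Z) lmonD T1_shift IH !addrA; congr (_ - _).
  rewrite mulrBr mulrDr !laurent_scaleAr -!lmonD.
  by congr (_ *: lmon _ _ + _ - _ *: lmon _ _); lia.
apply: lowD; last by apply/lowN/lowZ/low_mon; rewrite mon_rank_nat; lia.
apply: lowD; last by apply/lowN/lowZ/low_mon; rewrite mon_rank_nat; lia.
apply: low_mulmon low_g => m; rewrite /mon_rank; case: ifP; case: ifP; lia.
Qed.

Lemma T1_lmon_neg n : exists2 g, low n.*2 g &
  T1 (x (- n%:Z)) = k1 *: x n + g.
Proof.
elim: n => [|n [g low_g IH]].
  by exists 0; [exact: low0 | rewrite lmon0 T1_1 addr0].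
exists (x 1 * g + a1 *: x (- n.+1%:Z) + b1 *: x (- n%:Z)); last first.
  (* [T1_shift] is read backwards: taken at x^(-n-1), it is solved for T1 x^(-n-1). *)
  have := T1_shift (x (- n.+1%:Z)); rewrite -lmonD.
  have -> : 1 + - n.+1%:Z = - n%:Z by lia.
  move/esym/(canRL (subrK _))/(congr1 (fun f => x 1 * f)).
  rewrite mulrA -lmonD subrr lmon0 mul1r => /(canRL (subrK _)) ->.
  rewrite IH !mulrDr !laurent_scaleAr -!lmonD -!addrA; congr (_ *: _ + (_ + _)).
  by rewrite addrC; congr (_ + _ *: lmon _ _); lia.
apply: lowD; last by apply/lowZ/low_mon; rewrite ?mon_rank_nat ?mon_rank_opp; lia.
apply: lowD; last by apply/lowZ/low_mon; rewrite ?mon_rank_nat ?mon_rank_opp; lia.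
apply: low_mulmon low_g => m; rewrite /mon_rank; case: ifP; case: ifP; lia.
Qed.

(** The first 2n+1 monomials have the exponents from -n to n, a range symmetric under x -> x^-1, so
    [T1] preserves their span. *)
Lemma low_T1_lmon n m : (mon_rank m <= n.*2)%N -> low n.*2.+1 (T1 (x m)).
Proof.
case: m => [[|m]|m] le_m.
- by rewrite lmon0 T1_1 -lmon0; apply/lowZ/low_mon.
- have [g low_g ->] := T1_lmon_pos m; move: le_m; rewrite /mon_rank /= => le_m.
  apply: lowD; last by apply: lowS low_g; lia.
  by apply/lowZ/low_mon; rewrite ?mon_rank_nat ?mon_rank_opp; lia.
- have [g low_g] := T1_lmon_neg m.+1; move: le_m; rewrite /mon_rank /= => le_m.
  rewrite NegzE => ->.
  apply: lowD; last by apply: lowS low_g; lia.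
  by apply/lowZ/low_mon; rewrite mon_rank_nat; lia.
Qed.

(** * Iterated intertwiners and their leading coefficients *)

(* All three are indexed by the position k of the leading monomial in the list
   1, x^-1, x, x^-2, x^2, ... *)
Fixpoint AWvec (k : nat) : A :=
  if k is k'.+1 then
    (if odd k' then intertw1 (AWvec k') else intertw0 (AWvec k'))
  else 1.

Fixpoint AWeig (k : nat) : F :=
  if k is k'.+1 then (if odd k' then (AWeig k')^-1 else (q * AWeig k')^-1)
  else k0 * k1.

Fixpoint AWlead (k : nat) : F :=
  if k is k'.+1 then
    AWlead k' * (if odd k' then k1 * (AWeig k' - AWeig k)
                 else k1^-1 * (AWeig k - AWeig k'))
  else 1.

Lemma AWeig_neq0 k : AWeig k != 0.
Proof.
by elim: k => [|k IH] /=; [|case: odd]; rewrite ?invr_eq0 ?mulf_neq0.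
Qed.

Lemma Y_AWvec k : Yop (AWvec k) = AWeig k *: AWvec k.
Proof.
elim: k => [|k IH] /=.
  by rewrite -YopE T0_1 linearZ /= T1_1 scalerA.
by case: odd; [apply: intertw1_eigen | apply: intertw0_eigen]; rewrite ?AWeig_neq0.
Qed.

(** Odd positions carry x^(-n-1), which [T1] reflects to x^(n+1) with factor k1; at even positions
    x^n is first raised to x^(n+1), then reflected to x^(-n-1) with factor k1^-1. The eigenvalue
    differences come from [intertw1E] and [intertw0E]. *)
Lemma AWvec_lead k : exists2 g, low k g &
  AWvec k = AWlead k *: x (mon_unrank k) + g.
Proof.
elim: k => [|k [g low_g IH]].
  by exists 0; [exact: low0 | rewrite /= scale1r lmon0 addr0].
have e0 := AWeig_neq0 k; have Yk := Y_AWvec k.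
rewrite /=; have [odd_k|even_k] := ifP.
  have kE : k = (k./2).*2.+1 by lia.
  rewrite (intertw1E e0 Yk) IH linearP /=; move: (k./2) kE => n kE.
  have [h low_h] := T1_lmon_neg n.+1.
  have -> : mon_unrank k = - n.+1%:Z by rewrite kE mon_unrank_doubleS.
  move=> ->; exists ((AWeig k - (AWeig k)^-1) *: (AWlead k *: h + T1 g)
    - (a0 + a1 * AWeig k) *: (AWlead k *: x (- n.+1%:Z) + g)).
    apply: lowD.
      apply/lowZ/lowD; first by apply: lowZ; apply: lowS low_h; lia.
      apply: (@low_map _ T1 k) low_g => m; rewrite kE => lt_m.
      by apply: (@lowS _ n.*2.+1) => //; apply: low_T1_lmon.
    apply/lowN/lowZ/lowD; last by apply: lowS low_g.
    by apply/lowZ/low_mon; rewrite ?mon_rank_nat ?mon_rank_opp; lia.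
  have -> : mon_unrank k.+1 = n.+1%:Z.
    by rewrite kE -doubleS mon_unrank_double.
  rewrite [in RHS]addrA; congr (_ + _); rewrite !scalerDr !scalerA -!addrA.
  have -> : AWlead k * (k1 * (AWeig k - (AWeig k)^-1))
      = (AWeig k - (AWeig k)^-1) * AWlead k * k1 by ring.
  by [].
have kE : k = (k./2).*2 by lia.
have [c ->] := intertw0E e0 Yk.
rewrite IH; move: (k./2) kE => n kE.
have [h low_h] := T1_lmon_pos n.
have -> : mon_unrank k = n%:Z by rewrite kE mon_unrank_double.
rewrite mulrDr laurent_scaleAr -lmonD linearP /= -[1 + n%:Z]/(n.+1%:Z) => ->.
exists (((q * AWeig k)^-1 - AWeig k) *: (AWlead k *: h + T1 (x 1 * g))
  + c *: (AWlead k *: x n + g)).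
  apply: lowD; last first.
    apply/lowZ/lowD; last by apply: lowS low_g.
    by apply/lowZ/low_mon; rewrite mon_rank_nat; lia.
  apply/lowZ/lowD; first by rewrite kE; apply: lowZ.
  (* The exponents of [g] lie between -n and n-1, so those of x g stay in the symmetric range from
     -n to n. *)
  have : low n.*2.+1 (x 1 * g).
    by apply: low_mulmon low_g => m; rewrite /mon_rank; case: ifP; case: ifP; lia.
  by rewrite kE; apply: low_map => m; apply: low_T1_lmon.
have -> : mon_unrank k.+1 = - n.+1%:Z.
  by rewrite kE mon_unrank_doubleS.
rewrite [in RHS]addrA; congr (_ + _); rewrite !scalerDr !scalerA -!addrA.
have -> : AWlead k * (k1^-1 * ((q * AWeig k)^-1 - AWeig k))
    = ((q * AWeig k)^-1 - AWeig k) * AWlead k / k1 by ring.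
by [].
Qed.

(** * Uniqueness of the monic eigenvectors *)

Section Uniqueness.
Hypothesis AWeig_inj : injective AWeig.

Lemma AWlead_neq0 k : AWlead k != 0.
Proof.
elim: k => [|k IH]; first exact: oner_neq0.
have ne : AWeig k != AWeig k.+1 by apply/eqP => /AWeig_inj; lia.
rewrite [AWlead _]/= mulf_neq0 //; case: ifP => odd_k; rewrite mulf_neq0 ?invr_eq0 //.
  by move: ne; rewrite /= odd_k subr_eq0.
by move: ne; rewrite /= odd_k subr_eq0 eq_sym.
Qed.

Lemma low_AWvec k f :
  low k f -> exists a : nat -> F, f = \sum_(j < k) a j *: AWvec j.
Proof.
elim: k f => [|k IH] f [c ->].
  by exists (fun _ => 0); rewrite !big_ord0.
(* With coefficient [d] the iterate matches the top monomial; its lower part d g is then subtracted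
   before the induction hypothesis is used. *)
have [g low_g Ek] := AWvec_lead k; set d := c k / AWlead k.
have [a aE] : exists a : nat -> F, \sum_(i < k) c i *: x (mon_unrank i) - d *: g
     = \sum_(j < k) a j *: AWvec j.
  by apply: IH; apply: lowD; [exists c | apply/lowN/lowZ].
exists (fun j => if j == k then d else a j).
rewrite !big_ord_recr /= eqxx Ek scalerDr scalerA divfK ?AWlead_neq0 //.
have -> : \sum_(i < k) (if (i : nat) == k then d else a i) *: AWvec i
    = \sum_(i < k) c i *: x (mon_unrank i) - d *: g.
  by rewrite aE; apply: eq_bigr => i _; rewrite ltn_eqF.
by rewrite addrACA -addrA addNr addr0 addrC.
Qed.

Lemma low_eigen_eq0 k f : low k f -> Yop f = AWeig k *: f -> f = 0.
Proof.
move=> /low_AWvec[a fE] Yf; apply: (eigen_sum_eq0 Y_AWvec) fE Yf => j lt_j.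
by apply/eqP => /AWeig_inj ej; rewrite ej ltnn in lt_j.
Qed.

(** Two monic candidates share the leading monomial, so their difference is a lower eigenvector for
    the same eigenvalue and vanishes by [low_eigen_eq0]. *)
Lemma AWvec_unique k :
  unique (fun P => monic_of_degree (mon_unrank k) P /\ Yop P = AWeig k *: P)
    ((AWlead k)^-1 *: AWvec k).
Proof.
have [g low_g Ek] := AWvec_lead k; have Yk := Y_AWvec k.
have monicE : (AWlead k)^-1 *: AWvec k - x (mon_unrank k) = (AWlead k)^-1 *: g.
  by rewrite Ek scalerDr scalerA mulVf ?AWlead_neq0 // scale1r addrC addKr.
split.
  split; last by rewrite linearZ /= Yk !scalerA mulrC.
  by apply/monic_of_degreeP; rewrite mon_unrankK monicE; apply: lowZ.
move=> P [/monic_of_degreeP]; rewrite mon_unrankK => low_P YP.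
apply/eqP; rewrite eq_sym -subr_eq0; apply/eqP/(@low_eigen_eq0 k).
  have -> : P - (AWlead k)^-1 *: AWvec k
      = (P - x (mon_unrank k)) - (AWlead k)^-1 *: g.
    by rewrite -monicE opprB addrA subrK.
  by apply: lowD; [|apply/lowN/lowZ].
by rewrite linearB linearZ /= Yk YP scalerBr !scalerA mulrC.
Qed.

End Uniqueness.
End Intertwiners.

(** * Closed forms of the eigenvalues and leading coefficients *)

Section ClosedForms.
Variables (F : fieldType) (q k0 k1 : F).
Hypotheses (q_neq0 : q != 0) (k0_neq0 : k0 != 0) (k1_neq0 : k1 != 0).
Local Notation AWeig := (AWeig q k0 k1).
Local Notation AWlead := (AWlead q k0 k1).
Local Notation t := (q * k0 ^+ 2 * k1 ^+ 2).

Lemma AWeig_double n : AWeig n.*2 = k0 * k1 * q ^+ n.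
Proof.
elim: n => [|n IH]; first by rewrite mulr1.
rewrite doubleS /= odd_double /= IH invrK exprS; ring.
Qed.

Lemma AWeig_gamma k : AWeig k = gamma q k0 k1 (mon_unrank k).
Proof.
rewrite /gamma /eps -[k]odd_double_half; case: odd; rewrite ?add1n ?add0n.
  rewrite mon_unrank_doubleS /= odd_double AWeig_double.
  by rewrite exprN1 -exprnN -invfM exprS mulrCA.
by rewrite mon_unrank_double AWeig_double /= expr1z.
Qed.

Lemma gamma_inj : (forall j : int, q ^ j = 1 -> j = 0) ->
  (forall j : int, 1 <= j -> k0 ^+ 2 * k1 ^+ 2 <> q ^ (- j)) ->
  injective (gamma q k0 k1).
Proof.
move=> q_gen k_gen m n; rewrite /gamma.
have k0k1 : k0 * k1 != 0 by rewrite mulf_neq0.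
wlog : m n / n <= m => [wlog_le|le_nm].
  by case: (lerP n m) => [/wlog_le //|/ltW /wlog_le h /esym /h].
(* Equality across the two signs would give k0^2 k1^2 = q^(n-m) with m - n >= 1, which is excluded;
   for equal signs q^(m-n) = 1 decides. *)
have mixed : 0 <= m -> n < 0 -> k0 * k1 * q ^ m <> (k0 * k1)^-1 * q ^ n.
  move=> m_ge0 n_lt0 e; apply: (k_gen (m - n)); first by lia.
  rewrite opprB expfzDr // -exprMn expr2 -invr_expz.
  apply: (canRL (mulfK _)); first by rewrite expfz_neq0.
  by rewrite -[LHS]mulrA e mulVKf.
rewrite /eps; case: ifP => m_ge0; case: ifP => n_ge0.
- move=> /(mulfI (expfz_neq0 _ k0k1)) e; apply/eqP; rewrite -subr_eq0.
  by apply/eqP/q_gen; rewrite expfzDr // e -expfzDr // subrr.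
- by rewrite expr1z => /mixed []; lia.
- lia.
- move=> /(mulfI (expfz_neq0 _ k0k1)) e; apply/eqP; rewrite -subr_eq0.
  by apply/eqP/q_gen; rewrite expfzDr // e -expfzDr // subrr.
Qed.

(** With g = k0 k1 q^n, (q g)^-1 - g = (q g)^-1 (1 - q g^2), and q g^2 is t q^(2n). *)
Lemma AWlead_doubleS n : AWlead n.*2.+1 =
  AWlead n.*2 * (q ^- n.+1 * k0^-1 * k1^-1 ^+ 2 * (1 - t * q ^+ n.*2)).
Proof.
rewrite [LHS]/= odd_double /= AWeig_double exprS -addnn exprD.
have qn0 : q ^+ n != 0 by rewrite expf_neq0.
move: (AWlead _) => a; field; rewrite qn0 q_neq0 k0_neq0 k1_neq0 //.
Qed.

(** With g as before, (q g)^-1 - q g = (q g)^-1 (1 - q^2 g^2), and q^2 g^2 is t q^(2n+1). *)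
Lemma AWlead_Sdouble n : AWlead n.+1.*2 =
  AWlead n.*2.+1 * (q ^- n.+1 * k0^-1 * (1 - t * q ^+ n.*2.+1)).
Proof.
have -> : AWlead n.+1.*2 = AWlead n.*2.+1 *
    (k1 * ((q * AWeig n.*2)^-1 - (q * AWeig n.*2)^-1^-1)).
  by rewrite doubleS [LHS]/= /= odd_double.
rewrite AWeig_double invrK !exprS -addnn exprD.
have qn0 : q ^+ n != 0 by rewrite expf_neq0.
by move: (AWlead _) => a; field; rewrite qn0 q_neq0 k0_neq0 k1_neq0.
Qed.

Lemma AWlead_even m : AWlead m.*2 =
  q ^- ((m + 1) * m) * k0 ^- (2 * m) * k1 ^- (2 * m) * qpoch t q (2 * m).
Proof.
elim: m => [|m IH].
  by rewrite muln0 /qpoch big_ord0 !expr0 invr1 !mulr1.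
rewrite AWlead_Sdouble AWlead_doubleS IH -!mul2n.
rewrite (_ : (2 * m.+1 = (2 * m).+2)%N); last by lia.
rewrite (_ : ((m.+1 + 1) * m.+1 = (m + 1) * m + m.+1 + m.+1)%N); last by lia.
rewrite /qpoch !big_ord_recr /=; move: (\prod_(_ < _) _) => p.
(* Powers with symbolic exponents are generalized to nonzero atoms, which leaves an identity for
   [field]. *)
rewrite (exprD q _ m.+1) (exprD q _ m.+1).
have qm0 := expf_neq0 ((m + 1) * m) q_neq0.
move: (q ^+ _) qm0 => X X0; rewrite !exprS !expr0.
move: (q ^+ _) (q ^+ _) (k0 ^+ _) (k1 ^+ _) (expf_neq0 m q_neq0)
  (expf_neq0 (2 * m) k0_neq0) (expf_neq0 (2 * m) k1_neq0) => Q Q' K0 K1 q0 k00 k10.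
by field; rewrite X0 q0 k00 k10 k0_neq0 k1_neq0 q_neq0.
Qed.

Lemma AWlead_odd m : (0 < m)%N -> AWlead m.*2.-1 =
  q ^- (m ^ 2) * k0 ^ (1 - (2 * m)%:Z) * k1 ^- (2 * m)
    * qpoch t q (2 * m - 1).
Proof.
case: m => // m _; rewrite doubleS AWlead_doubleS AWlead_even.
rewrite (_ : 1 - _ = - (2 * m).+1%:Z); last by lia.
rewrite (_ : (2 * m.+1 - 1 = (2 * m).+1)%N); last by lia.
rewrite (_ : (2 * m.+1 = (2 * m).+2)%N); last by lia.
rewrite (_ : (m.+1 ^ 2 = (m + 1) * m + m.+1)%N); last by lia.
rewrite -[k0 ^ _]/(k0 ^- _) /qpoch big_ord_recr /= -mul2n.
move: (\prod_(_ < _) _) => p.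
rewrite (exprD q _ m.+1).
have qm0 := expf_neq0 ((m + 1) * m) q_neq0.
move: (q ^+ _) qm0 => X X0; rewrite !exprS !expr0.
move: (q ^+ _) (q ^+ _) (k0 ^+ _) (k1 ^+ _) (expf_neq0 m q_neq0)
  (expf_neq0 (2 * m) k0_neq0) (expf_neq0 (2 * m) k1_neq0) => Q Q' K0 K1 q0 k00 k10.
by field; rewrite X0 q0 k00 k10 k0_neq0 k1_neq0 q_neq0.
Qed.

End ClosedForms.

(** * Passage to the concrete operators *)

Lemma T1_const1 (F : fieldType) (k1 u1 : F) : T1 k1 u1 1 = k1 *: (1 : laurent F).
Proof.
apply: val_inj; rewrite -[LHS]/(ratl (T1 _ _ _)) T1E /T1_rat -[ratl 1]/1.
have [-> _] := rsubst_is_monoid_morphism (@transcendental_invX F).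
by rewrite subrr mulr0 addr0.
Qed.

Lemma T0_const1 (F : fieldType) (q qh k0 u0 : F) :
  q != 0 -> T0 q qh k0 u0 1 = k0 *: (1 : laurent F).
Proof.
move=> q0; apply: val_inj; rewrite -[LHS]/(ratl (T0 _ _ _ _ _)) T0E //.
rewrite /T0_rat -[ratl 1]/1.
have [-> _] := rsubst_is_monoid_morphism (transcendentalVX q0).
by rewrite subrr mulr0 addr0.
Qed.

Lemma op_inv_T1 (F : fieldType) (k1 u1 : F) (f : laurent F) :
  k1 != 0 -> u1 != 0 -> op_inv (T1 k1 u1) f = T1 k1 u1 f - (k1 - k1^-1) *: f.
Proof.
move=> k10 u10; have T1b := T1_bij k10 u10; apply: (bij_inj T1b).
rewrite op_inv_bij // addrC -scaleNr T1_linear T1_hecke //.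
by rewrite scaleNr addKr.
Qed.

Lemma nonsym_AW_unique (F : fieldType) (q qh k0 k1 u0 u1 : F) m P :
  unique (is_nonsym_AW q qh k0 k1 u0 u1 m) P ->
  nonsym_AW q qh k0 k1 u0 u1 m = P.
Proof.
move=> [PP uP]; rewrite /nonsym_AW.
by case: xgetP => [P' _ [PP' _]|/(_ P) []//]; rewrite (uP _ PP').
Qed.

Lemma expfz_norm_neq1 (C : numFieldType) (q : C) (j : int) :
  `|q| != 1 -> q ^ j = 1 -> j = 0.
Proof.
move=> q1; have expn_neq1 n : q ^+ n.+1 <> 1.
  move/(congr1 Num.norm)/eqP; rewrite normrX normr1.
  by rewrite pexpr_eq1 // (negPf q1).
case: (intP j) => // n; first by move/expn_neq1.
by rewrite -exprnN => /eqP; rewrite invr_eq1 => /eqP /expn_neq1.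
Qed.

Theorem proposition9p3 (R : realType) (q qh k0 k1 u0 u1 : R[i])
    (q_neq0 : q != 0) (q_norm : `|q| != 1) (qhE : qh ^+ 2 = q)
    (k0_neq0 : k0 != 0) (k1_neq0 : k1 != 0)
    (u0_neq0 : u0 != 0) (u1_neq0 : u1 != 0)
    (k0_gen : forall j : int, k0 ^+ 2 <> q ^ j /\ k0 ^+ 2 <> - q ^ j)
    (k1_gen : forall j : int, k1 ^+ 2 <> q ^ j /\ k1 ^+ 2 <> - q ^ j)
    (u1_gen : forall j : int, u1 ^+ 2 <> q ^ j /\ u1 ^+ 2 <> - q ^ j)
    (k0k1_gen : forall j : int, 1 <= j -> k0 ^+ 2 * k1 ^+ 2 <> q ^ (- j)) :
  let A : Type := laurent R[i] in
  let S1 : A -> A := S1 q qh k0 k1 u0 u1 in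
  let S0 : A -> A := S0 q qh k0 k1 u0 u1 in
  let P : int -> A := nonsym_AW q qh k0 k1 u0 u1 in
  (forall m : nat,
     iter m (S1 \o S0) 1 =
       (q ^- ((m + 1) * m) * k0 ^- (2 * m) * k1 ^- (2 * m)
        * qpoch (q * k0 ^+ 2 * k1 ^+ 2) q (2 * m)) *: P m%:Z) /\
  (forall m : nat, (1 <= m)%N ->
     S0 (iter (m - 1) (S1 \o S0) 1) =
       (q ^- (m ^ 2) * k0 ^ (1 - (2 * m)%:Z) * k1 ^- (2 * m)
        * qpoch (q * k0 ^+ 2 * k1 ^+ 2) q (2 * m - 1)) *: P (- m%:Z)).
Proof.
move=> A S1 S0 P.
pose T1c := GRing.isLinear.Build _ A A *:%R (T1 k1 u1) (@T1_linear _ k1 u1).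
pose T0c := GRing.isLinear.Build _ A A *:%R (T0 q qh k0 u0)
  (@T0_linear _ q qh k0 u0 q_neq0).
pose L1 : {linear A -> A} := HB.pack (T1 k1 u1) T1c.
pose L0 : {linear A -> A} := HB.pack (T0 q qh k0 u0) T0c.
have h0 := T0_hecke q_neq0 qhE k0_neq0 u0_neq0.
have h1 f := T1_hecke f k1_neq0 u1_neq0.
have s0 := T0_shift q_neq0 qhE k0_neq0 u0_neq0.
have s1 := T1_shift k1_neq0 u1_neq0.
have o0 := T0_const1 qh k0 u0 q_neq0.
have o1 := T1_const1 k1 u1.
have eig_inj : injective (AWeig q k0 k1).
  move=> i j; rewrite !AWeig_gamma // => /gamma_inj e.
  apply: (can_inj mon_unrankK); apply: e => // l.
  exact: expfz_norm_neq1.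
(* The normalized iterate is the definite description P; the nonzero [AWlead] then moves to the
   other side. *)
have PE k : AWvec k1 L0 L1 k = AWlead q k0 k1 k *: P (mon_unrank k).
  have := @AWvec_unique _ q k0 k1 _ _ L0 L1 q_neq0 k0_neq0 k1_neq0
    h0 h1 s0 s1 o0 o1 eig_inj k.
  rewrite AWeig_gamma // => /nonsym_AW_unique; rewrite /P => ->.
  by rewrite scalerA mulfV ?scale1r // AWlead_neq0.
(* Only [S0] contains the chosen inverse of [T1]; [S1] unfolds to [intertw1] directly. *)
have VE : T1v k1 u1 =1 Vop k1 L1 by move=> f; rewrite /T1v op_inv_T1.
have S0E f : S0 f = intertw0 k1 L0 L1 f by rewrite /S0 /Defs.S0 !VE.
have iterE m : iter m (S1 \o S0) 1 = AWvec k1 L0 L1 m.*2.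
  by elim: m => // m IH; rewrite iterS IH doubleS /= odd_double S0E.
split=> [m|m m_gt0].
  by rewrite iterE PE mon_unrank_double (AWlead_even q_neq0 k0_neq0 k1_neq0).
(* One [S0] after m-1 double steps is iterate number 2m-1, whose leading monomial is x^(-m). *)
have mE : m.*2.-1 = (m - 1).*2.+1 by lia.
have -> : S0 (iter (m - 1) (S1 \o S0) 1) = AWvec k1 L0 L1 m.*2.-1.
  by rewrite iterE S0E mE /= odd_double.
have mE' : (m - 1).+1 = m by lia.
by rewrite PE {2}mE mon_unrank_doubleS mE' (AWlead_odd q_neq0 k0_neq0 k1_neq0 m_gt0).
Qed.
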